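(* Let $n\ge1$, $a>0$. Let $\tau\sim\mathrm{gamma}(\lambda,1/2)$ with $\lambda=na$, let $\phi=(\phi_1,\dots,\phi_n)\sim\mathrm{Dir}(a,\dots,a)$ be independent of $\tau$, and, given $(\phi,\tau)$, let $\theta_j\sim\mathrm{DE}(\phi_j\tau)$ independently for $j=1,\dots,n$. Then the joint conditional (posterior) distribution of $\phi$ given $\theta=(\theta_1,\dots,\theta_n)$ (with $\tau$ integrated out) is the distribution of $(T_1/T,\dots,T_n/T)$, where $T_1,\dots,T_n$ are independent with $T_j\sim\mathrm{giG}(a-1,1,2|\theta_j|)$ and $T=\sum_{j=1}^nT_j$.
   Context: $\mathrm{DE}(\sigma)$ is the Laplace distribution with density $(2\sigma)^{-1}e^{-|y|/\sigma}$ on $\mathbb{R}$. $\mathrm{gamma}(\lambda,1/2)$ has density proportional to $\tau^{\lambda-1}e^{-\tau/2}$ on $(0,\infty)$. $\mathrm{Dir}(a,\dots,a)$ is the symmetric Dirichlet distribution on $\{\phi_j\ge0,\ \sum_{j=1}^n\phi_j=1\}$. The generalized inverse Gaussian distribution $\mathrm{giG}(\lambda,\rho,\chi)$ has density $f(y)\propto y^{\lambda-1}e^{-\frac12(\rho y+\chi/y)}$ for $y>0$. Conditional distributions are understood up to almost-sure equality. In the normal means model $y_i=\theta_i+\epsilon_i$ the vector $\phi$ is conditionally independent of the data $y$ given $\theta$, so this is the Gibbs-sampling full conditional of $\phi$ with $\tau$ marginalized out. *)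

(* Defs.v *)
From HB Require Import structures.
From mathcomp Require Import all_boot all_order all_algebra.
From mathcomp Require Import all_classical all_reals all_analysis.

Set Implicit Arguments.
Unset Strict Implicit.
Unset Printing Implicit Defensive.

Import Order.TTheory GRing.Theory Num.Theory.

Local Open Scope classical_set_scope.
Local Open Scope ring_scope.

(* Lebesgue measure on R^m, realised as m.-tuple R with its product
   sigma-algebra: the point mass on R^0, and the image of the product measure
   lebesgue_measure \x lebesgue_tuple m under (x, v) |-> x :: v on R^(m+1). *)
Section lebesgue_tuple.
Context (R : realType).

Section step.
Variables (m : nat) (mu : {sigma_finite_measure set (m.-tuple R) -> \bar R}).

Definition tuple_cons (p : measurableTypeR R * m.-tuple R) : m.+1.-tuple R :=
  [the m.+1.-tuple R of (p.1 : R) :: p.2].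

Let measurable_tuple_cons : measurable_fun setT tuple_cons.
Proof.
exact: (@measurable_cons _ _ _ R fst _ snd measurable_fst measurable_snd).
Qed.

Definition lebesgue_step : set (m.+1.-tuple R) -> \bar R :=
  pushforward (@lebesgue_measure R \x mu)%E tuple_cons.

Let step0 : lebesgue_step set0 = 0%E.
Proof. by rewrite /lebesgue_step /pushforward preimage_set0 measure0. Qed.

Let step_ge0 A : (0 <= lebesgue_step A)%E.
Proof. exact: measure_ge0. Qed.

Let step_sigma_additive : semi_sigma_additive lebesgue_step.
Proof.
move=> F mF tF mUF; rewrite /lebesgue_step /pushforward preimage_bigcup.
apply: measure_semi_sigma_additive.
- by move=> n; rewrite -[X in measurable X]setTI; exact: measurable_tuple_cons.
- apply/trivIsetP => /= i j _ _ ij; rewrite -preimage_setI.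
  by move/trivIsetP : tF => /(_ _ _ _ _ ij) ->//; rewrite preimage_set0.
- rewrite -preimage_bigcup -[X in measurable X]setTI.
  exact: measurable_tuple_cons.
Qed.

HB.instance Definition _ := isMeasure.Build _ _ _ lebesgue_step
  step0 step_ge0 step_sigma_additive.

Let step_sigma_finite : sigma_finite setT lebesgue_step.
Proof.
have /sigma_finiteP[F [TF ndF Foo]] := sigma_finiteT (@lebesgue_measure R).
have /sigma_finiteP[G [TG ndG Goo]] := sigma_finiteT mu.
pose u (v : m.+1.-tuple R) : measurableTypeR R * m.-tuple R :=
  (thead v, [tuple of behead v]).
have uK p : u (tuple_cons p) = p.
  by case: p => x v; rewrite /u; congr pair; apply: val_inj.
have mu_ : measurable_fun setT u.
  apply: measurable_fun_pair; last exact: measurable_behead.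
  exact: (@measurable_tnth _ R _ ord0).
exists (fun k => u @^-1` (F k `*` G k)).
  apply/esym/seteqP; split=> // v _.
  have [i _ Fi] : (\bigcup_k F k) (u v).1 by rewrite -TF.
  have [j _ Gj] : (\bigcup_k G k) (u v).2 by rewrite -TG.
  exists (maxn i j) => //; split.
  - by move: Fi; exact/subsetPset/ndF/leq_maxl.
  - by move: Gj; exact/subsetPset/ndG/leq_maxr.
move=> k; have [mF Fk] := Foo k; have [mG Gk] := Goo k; split.
  by rewrite -[X in measurable X]setTI; apply: mu_ => //; exact: measurableX.
rewrite /lebesgue_step /pushforward -comp_preimage.
rewrite (_ : u \o _ = id); last by apply/funext => p /=; exact: uK.
by rewrite preimage_id product_measure1E// lte_mul_pinfty// ge0_fin_numE.
Qed.

HB.instance Definition _ := Measure_isSigmaFinite.Build _ _ _ lebesgue_step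
  step_sigma_finite.

End step.

Fixpoint lebesgue_tuple (m : nat) :
    {sigma_finite_measure set (m.-tuple R) -> \bar R} :=
  match m with
  | 0 => \d_([tuple] : 0.-tuple R)
  | m'.+1 => lebesgue_step (lebesgue_tuple m')
  end.

End lebesgue_tuple.

Section laws.
Context (R : realType).
Notation leb := (@lebesgue_measure R).

(* mu is supported on ]0, +oo[ with density proportional to f there.  For a
   probability mu this forces 0 < \int f < +oo and determines c. *)
Definition pos_density_propto (mu : set R -> \bar R) (f : R -> R) : Prop :=
  exists2 c : R, 0 < c & forall A : set R, measurable A ->
    mu A = (\int[leb]_(x in A `&` `]0%R, +oo[) (c * f x)%:E)%E.

Definition is_gamma (lam rate : R) (mu : set R -> \bar R) : Prop :=
  pos_density_propto mu (fun x => x `^ (lam - 1) * expR (- (rate * x))).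

Definition is_giG (lam rho chi : R) (mu : set R -> \bar R) : Prop :=
  pos_density_propto mu
    (fun y => y `^ (lam - 1) * expR (- (2^-1 * (rho * y + chi / y)))).

Definition laplace_pdf (s y : R) : R := (2 * s)^-1 * expR (- (`|y| / s)).

Definition laplace_law (s : R) (A : set R) : \bar R :=
  (\int[leb]_(y in A) (laplace_pdf s y)%:E)%E.

(* (x_1, ..., x_(n-1)) |-> (x_1, ..., x_(n-1), 1 - \sum_k x_k): the default
   value of nth supplies the last coordinate. *)
Definition simplex_point (n : nat) (x : n.-1.-tuple R) : n.-tuple R :=
  [tuple nth (1 - \sum_(k < n.-1) tnth x k) x j | j < n].
Arguments simplex_point : clear implicits.

(* Density proportional to \prod_j phi_j^(a-1) on the simplex, with respect to
   Lebesgue measure in the first n-1 coordinates; the point mass at (1) when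
   n = 1. *)
Definition is_dirichlet (n : nat) (a : R) (mu : set (n.-tuple R) -> \bar R) :
    Prop :=
  exists2 c : R, 0 < c & forall A : set (n.-tuple R), measurable A ->
    mu A = (\int[lebesgue_tuple R n.-1]_(x in
              [set x | A (simplex_point n x) /\
                       forall j, (0 <= tnth (simplex_point n x) j)%R])
              (c * \prod_(j < n) tnth (simplex_point n x) j `^ (a - 1))%:E)%E.

End laws.

Section dependence.
Context (R : realType) (d : measure_display) (Omega : measurableType d).
Variable P : probability Omega R.

Definition independent_RVs (d1 d2 : measure_display) (T1 : measurableType d1)
    (T2 : measurableType d2) (X : {RV P >-> T1}) (Y : {RV P >-> T2}) : Prop :=
  forall (A : set T1) (B : set T2), measurable A -> measurable B ->
    P (X @^-1` A `&` Y @^-1` B) = (P (X @^-1` A) * P (Y @^-1` B))%E.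

(* The sets B j may be setT, so this gives the product rule for every
   subfamily. *)
Definition mutually_independent (n : nat) (X : 'I_n -> {RV P >-> R}) : Prop :=
  forall B : 'I_n -> set R, (forall j, measurable (B j)) ->
    P [set w | forall j, B j (X j w)] =
    \big[*%E/1%E]_(j < n) P (X j @^-1` B j).

(* Given Z, the coordinates of Y are independent and the j-th one has law
   K j Z: P(Y_j \in B_j for all j | Z) = \prod_j K j Z (B_j) almost surely. *)
Definition cond_independent_with_laws (n : nat) (d' : measure_display)
    (T' : measurableType d') (Y : {RV P >-> n.-tuple R}) (Z : Omega -> T')
    (K : 'I_n -> T' -> set R -> \bar R) : Prop :=
  forall (B : 'I_n -> set R) (C : set T'),
    (forall j, measurable (B j)) -> measurable C ->
    P ([set w | forall j, B j (tnth (Y w) j)] `&` Z @^-1` C) =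
    (\int[P]_(w in Z @^-1` C) \big[*%E/1%E]_(j < n) K j (Z w) (B j))%E.

(* K is a regular conditional distribution of X given Y. *)
Definition is_cond_distribution (d1 d2 : measure_display)
    (T1 : measurableType d1) (T2 : measurableType d2)
    (X : {RV P >-> T1}) (Y : {RV P >-> T2}) (K : R.-pker T2 ~> T1) : Prop :=
  forall (A : set T1) (B : set T2), measurable A -> measurable B ->
    P (X @^-1` A `&` Y @^-1` B) = (\int[P]_(w in Y @^-1` B) K (Y w) A)%E.

End dependence.

Definition normalize_tuple (R : realType) (n : nat) (t : 'I_n -> R) :
    n.-tuple R :=
  [tuple t j / \sum_(k < n) t k | j < n].

(* Q is the law of (T_1/T, ..., T_n/T), with T_1, ..., T_n independent,
   T_j ~ giG(lam, rho, chi_j) and T = \sum_j T_j. *)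
Definition is_normalized_giG (R : realType) (n : nat) (lam rho : R)
    (chi : 'I_n -> R) (Q : set (n.-tuple R) -> \bar R) : Prop :=
  exists (d : measure_display) (Omega : measurableType d)
    (P : probability Omega R) (T : 'I_n -> {RV P >-> R}),
    [/\ mutually_independent T,
        forall j, is_giG lam rho (chi j) (distribution P (T j)) &
        forall A : set (n.-tuple R), measurable A ->
          Q A = P [set w | A (normalize_tuple (fun j => T j w))]].

(* Main.v *)
(* Under the prior, T_j := phi_j * tau are independent gamma(a, 1/2) variables:
   in the coordinates t = s * phi, with s = \sum_j t_j, the product of the
   Dirichlet and gamma densities turns into the product of the gamma densities of
   the t_j, the Jacobian s ^ (n - 1) accounting for the shape n * a.  As theta_j
   is DE(T_j) given T, the pairs (T_j, theta_j) are independent, and their joint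
   density
     t^(a-1) e^(-t/2) (2t)^-1 e^(-|y|/t) = 2^-1 t^(a-2) e^(-(t + 2|y|/t)/2)
   is, for fixed y, proportional to the giG(a - 1, 1, 2|y|) density.  Hence the
   posterior law of T is a product of giG laws, and phi = T / \sum_j T_j.
   The normalizing constant is finite and nonzero for almost every theta simply
   because, up to a factor, it is the density of theta. *)
Require Import Defs.
From HB Require Import structures.
From mathcomp Require Import all_boot all_order all_algebra.
From mathcomp Require Import all_classical all_reals all_analysis.
From mathcomp Require Import measurable_realfun ring.

Set Implicit Arguments.
Unset Strict Implicit.
Unset Printing Implicit Defensive.

Import Order.TTheory GRing.Theory Num.Theory.

Local Open Scope classical_set_scope.
Local Open Scope ring_scope.

(** * Integration against measures with a density *)

Section transfer.
Local Open Scope ereal_scope.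
Context d1 d2 (X : measurableType d1) (Y : measurableType d2) (R : realType).
Variables (mu : {measure set X -> \bar R}) (nu : {measure set Y -> \bar R}).
Variables (f : X -> \bar R) (h : X -> Y).
Hypotheses (f0 : forall x, 0 <= f x) (mf : measurable_fun setT f).
Hypothesis mh : measurable_fun setT h.
Hypothesis nuE : forall A, measurable A ->
  nu A = \int[mu]_x (f x * (\1_A (h x))%:E).

Import HBNNSimple.

Let mfM (g : Y -> \bar R) : measurable_fun setT g ->
  measurable_fun setT (fun x => f x * g (h x)).
Proof. by move=> mg; apply: emeasurable_funM => //; exact: measurableT_comp. Qed.

Let transfer_nnsfun (g : {nnsfun Y >-> R}) :
  \int[nu]_y (g y)%:E = \int[mu]_x (f x * (g (h x))%:E).
Proof.
under eq_integral do rewrite fimfunE -fsumEFin//.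
have mind r : measurable_fun [set: Y]
    (fun y => (r * \1_(g @^-1` [set r]) y)%:E : \bar R).
  by apply/measurable_EFinP; exact: measurable_funM.
rewrite ge0_integral_fsum//; last first.
  by move=> r y _; exact: nnfun_muleindic_ge0.
transitivity (\int[mu]_x (\sum_(r \in range g)
    f x * (r * \1_(g @^-1` [set r]) (h x))%:E)).
  rewrite ge0_integral_fsum//; last 2 first.
  - by move=> r; exact: (mfM (mind r)).
  - by move=> r x _; rewrite mule_ge0//; exact: nnfun_muleindic_ge0.
  apply: eq_fsbigr => r /[!inE] -[y _ <-].
  rewrite (integralZl_indic _ (fun r => g @^-1` [set r]))//; last first.
    by move=> ?; rewrite preimage_nnfun0.
  rewrite integral_indic//= setIT nuE//.
  have gy0 : (0 <= (g y)%:E)%E by rewrite lee_fin.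
  rewrite -ge0_integralZl//; last 2 first.
  - by apply: (@mfM (fun z => (\1_(g @^-1` [set g y]) z)%:E)); exact/measurable_EFinP.
  - by move=> x _; rewrite mule_ge0.
  by apply: eq_integral => x _; rewrite muleCA EFinM.
apply: eq_integral => x _.
rewrite -ge0_mule_fsumr; last by move=> r; exact: nnfun_muleindic_ge0.
by rewrite fsumEFin// -fimfunE.
Qed.

(** [nu] is the image under [h] of [mu] weighted by [f], so the identity holds for indicators, then
    for simple functions, and by monotone convergence for all nonnegative measurable [g]. It
    replaces the laws of [tau], [phi] and [theta] by their densities; [h] is [simplex_point] for
    [phi] and the identity for the other two. *)
Lemma ge0_integral_transfer (g : Y -> \bar R) : (forall y, 0 <= g y) ->
  measurable_fun setT g -> \int[nu]_y g y = \int[mu]_x (f x * g (h x)).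
Proof.
move=> g0 mg; pose g_ := nnsfun_approx measurableT mg.
have gE y : g y = lim ((g_ n y)%:E @[n --> \oo]).
  by apply/esym/cvg_lim => //; exact: cvg_nnsfun_approx.
transitivity (lim (\int[nu]_y (g_ n y)%:E @[n --> \oo])).
  under eq_integral do rewrite gE.
  apply: monotone_convergence => //.
  - by move=> n; exact/measurable_EFinP.
  - by move=> n y _; rewrite lee_fin.
  - by move=> y _ m n mn; rewrite lee_fin; exact/lefP/nd_nnsfun_approx.
transitivity (lim (\int[mu]_x (f x * (g_ n (h x))%:E) @[n --> \oo])).
  by under eq_fun do rewrite transfer_nnsfun.
rewrite -monotone_convergence//.
- apply: eq_integral => x _.
  have g_sup : (fun n => (g_ n (h x))%:E) @ \oo --> g (h x).
    exact: cvg_nnsfun_approx.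
  (* [f x] may be infinite. Then, if [g (h x)] is zero, the approximants below it all vanish;
     otherwise the product of the limits is a determinate form. *)
  have [fx|] := boolP (f x \is a fin_num).
    by apply/cvg_lim => //; exact: cvgeZl.
  rewrite ge0_fin_numE// -leNgt leye_eq => /eqP ->.
  have [gx0|gx0] := eqVneq (g (h x)) 0.
    rewrite gx0 mule0; apply/cvg_lim => //.
    rewrite [X in X @ _ --> _](_ : _ = cst 0); first exact: cvg_cst.
    apply/funext => n /=; apply/eqP; rewrite eq_le mule_ge0 ?lee_fin ?f0//= andbT.
    rewrite mule_ge0_le0 ?leey//.
    by rewrite -[leRHS]gx0 nnsfun_approxE; exact: le_approx.
  apply/cvg_lim => //; apply: cvgeM => //; last exact: cvg_cst.
  by rewrite mule_defE (negbTE gx0).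
- by move=> n; apply: (@mfM (fun z => (g_ n z)%:E)); exact/measurable_EFinP.
- by move=> n x _; rewrite mule_ge0 ?lee_fin.
- move=> x _ m n mn; rewrite lee_wpmul2l//.
  by rewrite lee_fin; exact/lefP/nd_nnsfun_approx.
Qed.

End transfer.

(** * Kernels with a density, pushed forward along a map *)

Section density_kernel.
Local Open Scope ereal_scope.
Context d1 d2 d3 (X : measurableType d1) (Y : measurableType d2)
  (Z : measurableType d3) (R : realType).
Variables (mu : {sigma_finite_measure set Y -> \bar R}).
Variables (f : X * Y -> \bar R) (h : Y -> Z).
Hypotheses (f0 : forall p, 0 <= f p) (mf : measurable_fun setT f).
Hypothesis mh : measurable_fun setT h.

(* The proofs are arguments so that the measure structure can be inferred. *)
Definition density_measure of (forall p, 0 <= f p) & measurable_fun setT f &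
    measurable_fun setT h := fun (x : X) (A : set Z) =>
  \int[mu]_y (f (x, y) * (\1_A (h y))%:E).

Local Notation k := (density_measure f0 mf mh).

Let mfx x : measurable_fun setT (fun y => f (x, y)).
Proof. exact: measurableT_comp. Qed.

Let mpre A : measurable A -> measurable (h @^-1` A).
Proof. by move=> mA; rewrite -[X in measurable X]setTI; exact: mh. Qed.

Let kE x A : k x A = \int[mu]_(y in h @^-1` A) f (x, y).
Proof.
rewrite [RHS]integral_mkcond; apply: eq_integral => y _.
by rewrite epatch_indic.
Qed.

Let k0 x : k x set0 = 0.
Proof. by rewrite kE preimage_set0 integral_set0. Qed.

Let k_ge0 x A : 0 <= k x A.
Proof. by rewrite kE; exact: integral_ge0. Qed.

Let k_sigma_additive x : semi_sigma_additive (k x).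
Proof.
move=> F mF tF mUF; rewrite kE preimage_bigcup.
under eq_fun do under eq_bigr do rewrite kE.
apply: semi_sigma_additive_nng_induced => //.
- by move=> i; exact: mpre.
- apply/trivIsetP => /= i j _ _ ij; rewrite -preimage_setI.
  by move/trivIsetP : tF => /(_ _ _ _ _ ij) ->//; rewrite preimage_set0.
- by rewrite -preimage_bigcup; exact: mpre.
Qed.

HB.instance Definition _ x := isMeasure.Build _ _ _ (k x)
  (k0 x) (k_ge0 x) (@k_sigma_additive x).

(** Used with the same density for [h] the identity and for [h] the normalization onto the simplex,
    so that the second kernel is the image of the first. The masses may be infinite. *)
Definition density_kernel : X -> {measure set Z -> \bar R} :=
  fun x => k x.

Let mk A : measurable A -> measurable_fun [set: X] (density_kernel ^~ A).
Proof.
move=> mA; apply: (measurable_fun_fubini_tonelli_F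
  (fun p => f p * (\1_A (h p.2))%:E)).
  by apply: emeasurable_funM => //; apply/measurable_EFinP;
    apply: measurableT_comp => //; exact: measurableT_comp.
by move=> p; rewrite mule_ge0.
Qed.

HB.instance Definition _ := isKernel.Build _ _ _ _ _
  density_kernel mk.

End density_kernel.

(** * Measures on tuples are determined by rectangles *)

Section tuple_unique.
Context d (T : measurableType d) (R : realType) (n : nat).

Definition tuple_rectangle (B : 'I_n -> set T) : set (n.-tuple T) :=
  [set t | forall j, B j (tnth t j)].

Lemma measurable_tuple_rectangle (B : 'I_n -> set T) :
  (forall j, measurable (B j)) -> measurable (tuple_rectangle B).
Proof.
move=> mB; rewrite [X in measurable X](_ : _ =
    \bigcap_(j in setT) ((fun t => tnth t j) @^-1` B j)); last first.
  by apply/seteqP; split=> t /= Bt j; [move=> _|]; exact: Bt.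
apply: fin_bigcap_measurable => // j _; rewrite -[X in measurable X]setTI.
exact: measurable_tnth.
Qed.

(** Rectangles are stable under intersection, and they generate the sigma-algebra because a
    coordinate cylinder is a rectangle whose other sides are full. As the total mass is finite, the
    constant sequence [setT] is an admissible exhaustion. *)
Lemma tuple_measure_unique (m1 m2 : {measure set (n.-tuple T) -> \bar R}) :
  (m1 setT < +oo)%E ->
  (forall B : 'I_n -> set T, (forall j, measurable (B j)) ->
    m1 (tuple_rectangle B) = m2 (tuple_rectangle B)) ->
  forall A, measurable A -> m1 A = m2 A.
Proof.
move=> m1oo m12.
pose G := [set A | exists2 B : 'I_n -> set T,
  (forall j, measurable (B j)) & A = tuple_rectangle B].
apply: (measure_unique G (fun=> setT)) => //.
- rewrite eqEsubset; split; last first.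
    apply: smallest_sub; first exact: sigma_algebra_measurable.
    by move=> _ [B mB ->]; exact: measurable_tuple_rectangle.
  apply: smallest_sub; first exact: smallest_sigma_algebra.
  rewrite -bigcup_seq; apply: bigcup_sub => i /= _ A [C mC <-].
  apply: sub_sigma_algebra.
  exists (fun j => if j == i then C else setT).
    by move=> j; case: ifP.
  rewrite setTI; apply/seteqP; split=> t /=.
    by move=> Ct j; case: ifP => // /eqP ->.
  by move=> /(_ (i)); rewrite eqxx.
- move=> _ _ [B mB ->] [C mC ->]; exists (fun j => B j `&` C j).
    by move=> j; exact: measurableI.
  by apply/seteqP; split=> t; [move=> [Bt Ct] j|move=> BCt]; split=> // j;
     have [] := BCt j.
- by move=> _; exists (fun=> setT) => //; apply/seteqP.
- by rewrite bigcup_const.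
- by move=> _ [B mB ->]; exact: m12.
Qed.

End tuple_unique.

(** * Lebesgue measure on tuples *)

Section lebesgue_affine.
Local Open Scope ereal_scope.
Variable R : realType.
Local Notation leb := (@lebesgue_measure R).

Lemma ge0_integral_shift (f : R -> \bar R) (c : R) : (forall x, 0 <= f x) ->
  measurable_fun setT f -> \int[leb]_x f (x + c)%R = \int[leb]_x f x.
Proof.
move=> f0 mf.
have mc : measurable_fun setT (fun x : R => x + c : measurableTypeR R)%R.
  exact: measurable_funD.
transitivity (\int[pushforward leb (fun x : R => x + c : measurableTypeR R)%R]_x f x).
  by rewrite ge0_integral_pushforward.
apply: eq_measure_integral => A mA _.
apply/esym/lebesgue_measure_unique => // _ [[a b]] _ <-.
rewrite /= /pushforward (_ : _ @^-1` _ = [set` `]a - c, b - c]%R]); last first.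
  by apply/seteqP; split=> x /=; rewrite !in_itv/= ltrBlDr lerBrDr.
by rewrite !lebesgue_measure_itv/= !lte_fin ltrD2r -!EFinD opprB addrA subrK.
Qed.

(** [s] times the image of Lebesgue measure under dilation by [s] agrees with Lebesgue measure on
    half-open intervals, hence on all measurable sets. *)
Lemma ge0_integral_scale (f : R -> \bar R) (s : R) : (0 < s)%R ->
  (forall x, 0 <= f x) -> measurable_fun setT f ->
  \int[leb]_x f x = s%:E * \int[leb]_x f (s * x)%R.
Proof.
move=> s0 f0 mf.
have ms : measurable_fun [set: measurableTypeR R]
    (fun x : measurableTypeR R => (s * (x : R))%R : measurableTypeR R).
  exact: measurable_funM.
have s0' : (0 <= s)%R by exact: ltW.
have /= := ge0_integral_pushforward ms leb measurableT mf (in1W f0).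
rewrite preimage_setT => <-.
rewrite -[s]/((NngNum s0')%:num)%R -ge0_integral_mscale//.
apply: eq_measure_integral => A mA _.
apply: lebesgue_measure_unique => // _ [[a b]] _ <-.
rewrite /= /mscale/= /pushforward (_ : _ @^-1` _ = [set` `]a / s, b / s]%R]); last first.
  by apply/seteqP; split=> x /=; rewrite !in_itv/= ltr_pdivrMr// ler_pdivlMr// mulrC.
rewrite !lebesgue_measure_itv/= !lte_fin ltr_pM2r ?invr_gt0//.
case: ifPn => _; last by rewrite mule0.
by rewrite -!EFinD -EFinM -mulrBl mulrC divfK// gt_eqF.
Qed.

End lebesgue_affine.

(** * Iterated integrals and dilations on tuples *)

Section lebesgue_tuple_integral.
Local Open Scope ereal_scope.
Variable R : realType.
Local Notation leb := (@lebesgue_measure R).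
Local Notation lebn := (lebesgue_tuple R).

Lemma measurable_tuple_cons m : measurable_fun setT (@tuple_cons R m).
Proof.
exact: (@measurable_cons _ _ _ R fst _ snd measurable_fst measurable_snd).
Qed.

Lemma integral_lebesgue_tuple0 (f : 0.-tuple R -> \bar R) :
  measurable_fun setT f -> \int[lebn 0]_t f t = f [tuple].
Proof. by move=> mf; rewrite integral_dirac// diracT mul1e. Qed.

Lemma integral_lebesgue_tupleS m (f : m.+1.-tuple R -> \bar R) :
  (forall t, 0 <= f t) -> measurable_fun setT f ->
  \int[lebn m.+1]_t f t = \int[leb]_x \int[lebn m]_v f [tuple of x :: v].
Proof.
move=> f0 mf.
transitivity (\int[(leb \x lebn m)%E]_p f (tuple_cons p)).
  have /= := ge0_integral_pushforward (@measurable_tuple_cons m)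
    (leb \x lebn m)%E measurableT mf (in1W f0).
  by rewrite preimage_setT => <-.
rewrite fubini_tonelli1//.
by apply: measurableT_comp => //; exact: measurable_tuple_cons.
Qed.

Lemma measurable_lebesgue_tuple_cons m (f : m.+1.-tuple R -> \bar R) :
  (forall t, 0 <= f t) -> measurable_fun setT f ->
  measurable_fun setT (fun x : R => \int[lebn m]_v f [tuple of x :: v]).
Proof.
move=> f0 mf; apply: (measurable_fun_fubini_tonelli_F
  (fun p : measurableTypeR R * m.-tuple R => f (tuple_cons p))) => //.
by apply: measurableT_comp => //; exact: measurable_tuple_cons.
Qed.

Lemma measurable_tuple_rcons m : measurable_fun setT
  (fun p : m.-tuple R * R => [tuple of rcons p.1 p.2]).
Proof.
apply/measurable_fun_tnthP => i.
have [im|im] := ltnP i m.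
  rewrite (_ : _ \o _ = fun p => tnth p.1 (Ordinal im)).
    by apply: (measurableT_comp (measurable_tnth (Ordinal im))).
  apply/funext => p /=; rewrite !(tnth_nth 0%R)/= nth_rcons size_tuple im//.
rewrite (_ : _ \o _ = snd)//.
apply/funext => p /=; rewrite !(tnth_nth 0%R)/= nth_rcons size_tuple ltnNge im/=.
by rewrite ifT// eqn_leq im andbT -ltnS.
Qed.

(** [lebesgue_tuple] prepends coordinates, whereas [simplex_point] computes the last one, so the
    last coordinate has to become the innermost variable. The induction strips the first coordinate
    from both sides. *)
Lemma integral_lebesgue_tuple_rcons m (f : m.+1.-tuple R -> \bar R) :
  (forall t, 0 <= f t) -> measurable_fun setT f ->
  \int[lebn m.+1]_t f t = \int[lebn m]_v \int[leb]_x f [tuple of rcons v x].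
Proof.
have mrc k (g : k.+1.-tuple R -> \bar R) : (forall t, 0 <= g t) ->
    measurable_fun setT g ->
    measurable_fun setT (fun v : k.-tuple R => \int[leb]_x g [tuple of rcons v x]).
  move=> g0 mg; apply: (measurable_fun_fubini_tonelli_F
    (fun p : k.-tuple R * measurableTypeR R => g [tuple of rcons p.1 p.2])) => //.
  by apply: measurableT_comp => //; exact: measurable_tuple_rcons.
have mcons x k (g : k.+1.-tuple R -> \bar R) : measurable_fun setT g ->
    measurable_fun setT (fun v : k.-tuple R => g [tuple of x :: v]).
  by move=> mg; apply: measurableT_comp => //; exact: measurable_cons.
elim: m f => [|m IH] f f0 mf.
  rewrite integral_lebesgue_tupleS//.
  rewrite integral_lebesgue_tuple0; last exact: mrc.
  apply: eq_integral => x _; rewrite integral_lebesgue_tuple0; last exact: mcons.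
  by congr f; apply: val_inj.
rewrite (integral_lebesgue_tupleS f0 mf).
rewrite (integral_lebesgue_tupleS _ (mrc _ _ f0 mf)); last first.
  by move=> v; exact: integral_ge0.
apply: eq_integral => x _; rewrite (IH _ _ (mcons x _ _ mf)); last by [].
apply: eq_integral => v _; apply: eq_integral => y _.
by congr f; apply: val_inj.
Qed.

Lemma measurable_tuple_scale (s : R) m : measurable_fun setT
  (fun t : m.-tuple R => [tuple of map ( *%R s) t]).
Proof.
apply/measurable_fun_tnthP => i.
rewrite (_ : _ \o _ = fun t => s * tnth t i)%R; last first.
  by apply/funext => t /=; rewrite tnth_map.
by apply: measurable_funM => //; exact: measurable_tnth.
Qed.

Lemma integral_lebesgue_tuple_scale m (f : m.-tuple R -> \bar R) (s : R) :
  (0 < s)%R -> (forall t, 0 <= f t) -> measurable_fun setT f ->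
  \int[lebn m]_t f t =
  (s ^+ m)%:E * \int[lebn m]_t f [tuple of map ( *%R s) t].
Proof.
move=> s0.
have mscal k := @measurable_tuple_scale s k.
elim: m f => [|m IH] f f0 mf.
  rewrite expr0 mul1e !integral_lebesgue_tuple0//.
    by congr f; apply: val_inj.
  exact: (measurableT_comp mf (mscal 0%N)).
have mcons x : measurable_fun setT (fun v : m.-tuple R => f [tuple of x :: v]).
  by apply: measurableT_comp => //; exact: measurable_cons.
rewrite (integral_lebesgue_tupleS f0 mf) (ge0_integral_scale s0); last 2 first.
- by move=> x; exact: integral_ge0.
- exact: measurable_lebesgue_tuple_cons.
have mfs := measurableT_comp mf (mscal m.+1).
rewrite (integral_lebesgue_tupleS _ mfs); last by move=> t; exact: f0.
rewrite exprS EFinM -muleA; congr (_ * _).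
rewrite -ge0_integralZl; last 4 first.
- by [].
- by apply: (measurable_lebesgue_tuple_cons _ mfs) => t; exact: f0.
- by move=> x _; apply: integral_ge0 => v _; exact: f0.
- by rewrite lee_fin exprn_ge0// ltW.
apply: eq_integral => x _; rewrite (IH _ _ (mcons _)); last by [].
congr (_ * _).
by apply: eq_integral => v _; congr f; apply: val_inj.
Qed.

End lebesgue_tuple_integral.

(** * Product integrands and polar coordinates over the simplex *)

Section lebesgue_tuple_polar.
Local Open Scope ereal_scope.
Variable R : realType.
Local Notation leb := (@lebesgue_measure R).
Local Notation lebn := (lebesgue_tuple R).

Lemma emeasurable_prod d (T : measurableType d) (I : Type) (r : seq I)
    (f : I -> T -> \bar R) :
  (forall i, measurable_fun setT (f i)) ->
  measurable_fun setT (fun x => \prod_(i <- r) f i x).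
Proof.
move=> mf; elim: r => [|i r IH].
  by under eq_fun do rewrite big_nil; exact: measurable_cst.
by under eq_fun do rewrite big_cons; exact: emeasurable_funM.
Qed.

Lemma ge0_integral_lebesgue_tuple_prod n (f : 'I_n -> R -> \bar R) :
  (forall i x, 0 <= f i x) -> (forall i, measurable_fun setT (f i)) ->
  \int[lebn n]_t \prod_(i < n) f i (tnth t i) =
  \prod_(i < n) \int[leb]_x f i x.
Proof.
have mprod k (g : 'I_k -> R -> \bar R) : (forall i, measurable_fun setT (g i)) ->
    measurable_fun setT (fun t : k.-tuple R => \prod_(i < k) g i (tnth t i)).
  move=> mg; apply: (@emeasurable_prod _ (k.-tuple R) _ _
    (fun i t => g i (tnth t i))) => i.
  by apply: measurableT_comp => //; exact: measurable_tnth.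
elim: n f => [|n IH] f f0 mf.
  by rewrite big_ord0 (integral_lebesgue_tuple0 (mprod _ _ mf)) big_ord0.
rewrite (integral_lebesgue_tupleS _ (mprod _ _ mf)); last first.
  by move=> t; apply: prode_ge0 => i _.
under eq_integral => x _.
  under eq_integral => v _.
    rewrite big_ord_recl tnth0.
    under eq_bigr do rewrite tnthS.
    over.
  rewrite ge0_integralZl; last 4 first.
  - by [].
  - by apply: (mprod n (fun i => f (lift ord0 i))) => i; exact: mf.
  - by move=> v _ /=; apply: prode_ge0 => i _; exact: f0.
  - by [].
  rewrite (IH (fun i => f (lift ord0 i)))//.
  over.
rewrite /= (ge0_integralZr leb measurableT (mf ord0)) ?big_ord_recl//.
by apply: prode_ge0 => i _; exact: integral_ge0.
Qed.

(** Dilation followed by the shear ends at the dilated simplex point: the remainder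
    [s - \sum_k s * v_k] is [s] times the default coordinate of [simplex_point]. *)
Lemma simplex_point_rcons m (s : R) (v : m.-tuple R) :
  [tuple of rcons (map ( *%R s) v) (s - \sum_(k < m) (s * tnth v k))%R] =
  [tuple of map ( *%R s) (simplex_point (n := m.+1) v)] :> m.+1.-tuple R.
Proof.
apply: eq_from_tnth => j; rewrite [RHS]tnth_map tnth_mktuple (tnth_nth 0%R)/=.
rewrite nth_rcons size_map size_tuple.
have [jm|jm] := ltnP j m.
  rewrite (nth_map 0%R) ?size_tuple//; congr (_ * _)%R.
  by apply: set_nth_default; rewrite size_tuple.
rewrite ifT; last by rewrite eqn_leq jm andbT -ltnS.
by rewrite nth_default ?size_tuple// mulrBr mulr1 mulr_sumr.
Qed.

(* The map (s, x) |-> s * simplex_point x is the dilation v = s * x followed by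
   the shear (s, v) |-> (v, s - \sum_k v_k), hence the Jacobian s ^ m. *)
Lemma integral_lebesgue_tuple_polar m (G : m.+1.-tuple R -> \bar R) :
  (forall t, 0 <= G t) -> measurable_fun setT G ->
  (forall t, ~~ (0 < \sum_(j < m.+1) tnth t j)%R -> G t = 0) ->
  \int[lebn m.+1]_t G t =
  \int[leb]_s (if (0 < s)%R then (s ^+ m)%:E *
    \int[lebn m]_x G [tuple of map ( *%R s) (simplex_point (n := m.+1) x)]
    else 0).
Proof.
move=> G0 mG Gz.
(* [H] is [G] with the last coordinate expressed through the total [p.2]; for fixed [p.1] this is a
   translation, which preserves the integral. *)
pose H (p : m.-tuple R * measurableTypeR R) :=
  G [tuple of rcons p.1 ((p.2 : R) - \sum_(k < m) tnth p.1 k)%R].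
have msum k : measurable_fun setT (fun t : k.-tuple R => \sum_(i < k) tnth t i)%R.
  by apply: measurable_sum => i; exact: measurable_tnth.
have mH : measurable_fun setT H.
  apply: (measurableT_comp mG).
  apply: (measurableT_comp (@measurable_tuple_rcons R m)
    (g := fun p : m.-tuple R * measurableTypeR R =>
      (p.1, (p.2 : R) - \sum_(k < m) tnth p.1 k)%R)).
  apply: measurable_fun_pair => //; apply: measurable_funB => //.
  exact: (measurableT_comp (msum m) measurable_fst).
rewrite (integral_lebesgue_tuple_rcons G0 mG).
transitivity (\int[lebn m]_v \int[leb]_s H (v, s)).
  apply: eq_integral => v _.
  rewrite -(@ge0_integral_shift _ (fun x => G [tuple of rcons v x])
    (- \sum_(k < m) tnth v k)%R)//.
  apply: (measurableT_comp mG).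
  apply: (measurableT_comp (@measurable_tuple_rcons R m)
    (g := fun x : R => (v, x))).
  exact: measurable_fun_pair.
(* With the total [s] outermost, a nonpositive [s] contributes nothing by [Gz], and for a positive
   one the other coordinates are dilated by [s]. *)
rewrite (fubini_tonelli H mH (fun p => G0 _)).
apply: eq_integral => s _; case: ifPn => [s0|sN0]; last first.
  apply: integral0_eq => v _; apply: Gz.
  rewrite big_ord_recr /= (tnth_nth 0%R)/= nth_rcons size_tuple ltnn eqxx.
  under eq_bigr => i _ do rewrite (tnth_nth 0%R)/= nth_rcons size_tuple ltn_ord -tnth_nth.
  by rewrite addrC subrK.
rewrite (@integral_lebesgue_tuple_scale _ _ (fun v => H (v, s)) _ s0); last 2 first.
- by move=> v; exact: G0.
- apply: (measurableT_comp mH (g := fun v : m.-tuple R => (v, s))).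
  exact: measurable_fun_pair.
congr (_ * _); apply: eq_integral => v _; rewrite -simplex_point_rcons; congr G.
apply: val_inj => /=; congr rcons; congr (_ - _)%R.
by apply: eq_bigr => i _; rewrite tnth_map.
Qed.

End lebesgue_tuple_polar.

(** * The joint density of a scale and an observation *)

Section joint_density.
Variables (R : realType) (a : R).
Local Notation leb := (@lebesgue_measure R).

(** [laplace_pdf] is negative at negative scales. The cutoff makes the integrands nonnegative on the
    whole line, as Tonelli requires, and confines [joint_pdf] to [u > 0]. *)
Definition laplace_pdf_pos (u y : R) : R := if 0 < u then laplace_pdf u y else 0.

(** The unnormalized gamma(a, 1/2) density, without a cutoff: in [joint_pdf] the Laplace factor
    vanishes for [u <= 0]. *)
Definition gamma_kernel (u : R) : R := u `^ (a - 1) * expR (- (2^-1 * u)).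

Definition joint_pdf (y u : R) : R := gamma_kernel u * laplace_pdf_pos u y.

Lemma laplace_pdf_pos_ge0 u y : 0 <= laplace_pdf_pos u y.
Proof.
rewrite /laplace_pdf_pos; case: ifPn => // u0.
by rewrite /laplace_pdf mulr_ge0 ?expR_ge0// invr_ge0 mulr_ge0// ltW.
Qed.

Lemma gamma_kernel_ge0 u : 0 <= gamma_kernel u.
Proof. by rewrite mulr_ge0 ?powR_ge0 ?expR_ge0. Qed.

Lemma joint_pdf_ge0 y u : 0 <= joint_pdf y u.
Proof. by rewrite mulr_ge0 ?gamma_kernel_ge0 ?laplace_pdf_pos_ge0. Qed.

Lemma joint_pdf0 y u : u <= 0 -> joint_pdf y u = 0.
Proof. by move=> u0; rewrite /joint_pdf /laplace_pdf_pos ltNge u0 mulr0. Qed.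

Lemma joint_pdf_giG y u : 0 < u -> joint_pdf y u =
  2^-1 * (u `^ (a - 1 - 1) * expR (- (2^-1 * (1 * u + 2 * `|y| / u)))).
Proof.
move=> u0; rewrite /joint_pdf /gamma_kernel /laplace_pdf_pos u0 /laplace_pdf.
have un0 : u != 0 by rewrite gt_eqF.
have -> : u `^ (a - 1 - 1) = u `^ (a - 1) * u^-1.
  by rewrite powRD ?un0 ?implybT// powR_inv1// ltW.
rewrite (_ : - (2^-1 * (1 * u + 2 * `|y| / u)) =
  - (2^-1 * u) + - (`|y| / u)); last by field.
by rewrite expRD; field.
Qed.

Lemma measurable_invr : measurable_fun [set: R] (fun x : R => x^-1).
Proof.
rewrite (_ : (fun _ => _) = fun x : R => x * (x ^+ 2) `^ (-1)); last first.
  apply/funext => x; rewrite powR_inv1 ?sqr_ge0//.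
  have [->|x0] := eqVneq x 0; first by rewrite invr0 mul0r.
  by field.
apply: measurable_funM => //.
apply: (measurableT_comp (measurable_powR (-1))).
exact: measurable_funX.
Qed.

Lemma measurable_laplace_pdf_pos :
  measurable_fun [set: R * R] (fun p => laplace_pdf_pos p.2 p.1).
Proof.
apply: measurable_fun_ifT => //; last first.
  apply: measurable_funM.
    by apply: measurableT_comp measurable_invr _; exact: measurable_funM.
  apply: measurableT_comp => //; apply: measurableT_comp => //.
  apply: measurable_funM; first exact: measurableT_comp.
  exact: measurableT_comp measurable_invr _.
exact: measurable_fun_ltr.
Qed.

Lemma measurable_gamma_kernel : measurable_fun [set: R] gamma_kernel.
Proof.
apply: measurable_funM; first exact: measurable_powR.
by apply: measurableT_comp => //; apply: measurableT_comp => //;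
  exact: measurable_funM.
Qed.

Lemma measurable_joint_pdf :
  measurable_fun [set: R * R] (fun p => joint_pdf p.1 p.2).
Proof.
apply: measurable_funM; last exact: measurable_laplace_pdf_pos.
exact: (measurableT_comp measurable_gamma_kernel).
Qed.

Lemma measurable_simplex_point m :
  measurable_fun setT (simplex_point (n := m.+1) : m.-tuple R -> m.+1.-tuple R).
Proof.
apply/measurable_fun_tnthP => j.
have [jm|jm] := ltnP j m.
  rewrite (_ : _ \o _ = fun x => tnth x (Ordinal jm)); last first.
    apply/funext => x /=; rewrite tnth_mktuple (tnth_nth 0).
    by apply: set_nth_default; rewrite size_tuple.
  exact: measurable_tnth.
rewrite (_ : _ \o _ = fun x => 1 - \sum_(k < m) tnth x k); last first.
  by apply/funext => x /=; rewrite tnth_mktuple nth_default// size_tuple.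
apply: measurable_funB => //; apply: measurable_sum => i.
exact: measurable_tnth.
Qed.

Lemma sum_simplex_point m (x : m.-tuple R) :
  \sum_(j < m.+1) tnth (simplex_point (n := m.+1) x) j = 1.
Proof.
rewrite big_ord_recr/= tnth_mktuple /= nth_default ?size_tuple//.
under eq_bigr => i _.
  rewrite tnth_mktuple/= (set_nth_default 0) ?size_tuple// -tnth_nth.
  over.
by rewrite addrC subrK.
Qed.

Lemma measurable_normalize_tuple n : measurable_fun setT
  (fun t : n.-tuple R => normalize_tuple (tnth t)).
Proof.
apply/measurable_fun_tnthP => j.
rewrite (_ : _ \o _ = fun t => tnth t j / \sum_(k < n) tnth t k); last first.
  by apply/funext => t /=; rewrite tnth_mktuple.
apply: measurable_funM; first exact: measurable_tnth.
apply: measurableT_comp measurable_invr _; apply: measurable_sum => i.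
exact: measurable_tnth.
Qed.

(** Normalization inverts the polar map: the radius [s] cancels, which recovers [phi] from
    [tau * phi]. *)
Lemma normalize_tuple_scale n (s : R) (p : n.-tuple R) :
  s != 0 -> \sum_(k < n) tnth p k = 1 ->
  normalize_tuple (tnth [tuple of map ( *%R s) p]) = p.
Proof.
move=> s0 p1; apply: eq_from_tnth => j; rewrite tnth_mktuple tnth_map.
under eq_bigr do rewrite tnth_map.
by rewrite -mulr_sumr p1 mulr1 mulrAC divff// mul1r.
Qed.

(** Up to a constant, the joint density of the observations at [y] and of the scales at [t]. *)
Definition joint_pdf_tuple n (y t : n.-tuple R) : R :=
  \prod_(j < n) joint_pdf (tnth y j) (tnth t j).

Lemma joint_pdf_tuple_ge0 n (y t : n.-tuple R) : 0 <= joint_pdf_tuple y t.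
Proof. by apply: prodr_ge0 => j _; exact: joint_pdf_ge0. Qed.

Lemma measurable_joint_pdf_tuple n : measurable_fun setT
  (fun p : n.-tuple R * n.-tuple R => joint_pdf_tuple p.1 p.2).
Proof.
apply: measurable_prod => j _.
apply: (measurableT_comp measurable_joint_pdf
  (g := fun p : n.-tuple R * n.-tuple R => (tnth p.1 j, tnth p.2 j))).
by apply: measurable_fun_pair;
  apply: (measurableT_comp (measurable_tnth j)).
Qed.

End joint_density.

(** * Laplace probabilities as functions of the scale *)

Section laplace_mass.
Local Open Scope ereal_scope.
Variables (R : realType) (a : R).
Local Notation leb := (@lebesgue_measure R).

(** A version of [laplace_law] that is nonnegative at every real scale and zero at nonpositive
    ones. *)
Definition laplace_mass (B : set R) (u : R) : \bar R :=
  \int[leb]_y (\1_B y * laplace_pdf_pos u y)%:E.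

Lemma laplace_mass_ge0 B u : 0 <= laplace_mass B u.
Proof.
by apply: integral_ge0 => y _; rewrite lee_fin mulr_ge0 ?laplace_pdf_pos_ge0.
Qed.

Lemma laplace_mass0 B u : (u <= 0)%R -> laplace_mass B u = 0.
Proof.
move=> u0; apply: integral0_eq => y _.
by rewrite /laplace_pdf_pos ltNge u0 mulr0.
Qed.

(* At u = 0 the convention 0^-1 = 0 makes laplace_pdf vanish. *)
Lemma laplace_law_mass (B : set R) u : (0 <= u)%R ->
  laplace_law u B = laplace_mass B u.
Proof.
move=> u0; rewrite /laplace_law integral_mkcond; apply: eq_integral => y _.
rewrite epatch_indic -EFinM mulrC /laplace_pdf_pos.
case: ifPn => // uN0; suff -> : u = 0%R by rewrite /laplace_pdf mulr0 invr0 mul0r.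
by apply/eqP; rewrite eq_le u0 leNgt uN0.
Qed.

Lemma measurable_indic_laplace_pdf_pos (B : set R) : measurable B ->
  measurable_fun setT (fun p : R * R => (\1_B p.1 * laplace_pdf_pos p.2 p.1)%R).
Proof.
move=> mB; apply: measurable_funM; last exact: measurable_laplace_pdf_pos.
exact: measurableT_comp.
Qed.

Lemma measurable_laplace_mass (B : set R) : measurable B ->
  measurable_fun setT (laplace_mass B).
Proof.
move=> mB; apply: (measurable_fun_fubini_tonelli_G (m1 := leb)
  (fun p : measurableTypeR R * R => (\1_B (p.1 : R) * laplace_pdf_pos p.2 p.1)%:E)).
  apply/measurable_EFinP; exact: measurable_indic_laplace_pdf_pos.
by move=> p; rewrite lee_fin mulr_ge0 ?laplace_pdf_pos_ge0.
Qed.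

Lemma gamma_kernel_laplace_mass (B : set R) u : measurable B ->
  \int[leb]_y (\1_B y * joint_pdf a y u)%:E =
  (gamma_kernel a u)%:E * laplace_mass B u.
Proof.
move=> mB; rewrite -ge0_integralZl//; last 3 first.
- apply/measurable_EFinP; apply: (measurableT_comp
    (measurable_indic_laplace_pdf_pos mB) (g := fun y : R => (y, u))).
  exact: measurable_fun_pair.
- by move=> y _; rewrite lee_fin mulr_ge0 ?laplace_pdf_pos_ge0.
- by rewrite lee_fin gamma_kernel_ge0.
by apply: eq_integral => y _; rewrite -EFinM mulrCA.
Qed.

End laplace_mass.

(** * Expectations under independence *)

Section independent_integral.
Local Open Scope ereal_scope.
Context (R : realType) (d d1 d2 : measure_display) (Omega : measurableType d)
  (T1 : measurableType d1) (T2 : measurableType d2).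
Variable P : probability Omega R.
Variables (X : {RV P >-> T1}) (Y : {RV P >-> T2}).

(** The law of the pair agrees with the product of the two laws on rectangles, hence is equal to it;
    Tonelli then puts [Y] outermost, where the radius [tau] will stand. *)
Lemma ge0_independent_integral (W : T1 * T2 -> \bar R) :
  independent_RVs X Y -> (forall p, 0 <= W p) -> measurable_fun setT W ->
  \int[P]_w W (X w, Y w) =
  \int[distribution P Y]_y \int[distribution P X]_x W (x, y).
Proof.
move=> XY W0 mW; rewrite -fubini_tonelli2//.
have mXY : measurable_fun setT (fun w => (X w, Y w)) by exact: measurable_fun_pair.
have /= := ge0_integral_pushforward mXY P measurableT mW (in1W W0).
rewrite preimage_setT /comp/= => <-.
apply: eq_measure_integral => A mA _; apply/esym.
by apply: product_measure_unique => // B C mB mC; rewrite -XY.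
Qed.

End independent_integral.

Section polar_pointwise.
Local Open Scope ereal_scope.
Variables (R : realType) (a : R).

Lemma prod_gamma_kernel_scale n (s : R) (p : 'I_n -> R) : (0 < s)%R ->
  (forall j, 0 < p j)%R ->
  (\prod_(j < n) gamma_kernel a (s * p j) =
   s `^ (n%:R * (a - 1)) * (\prod_(j < n) p j `^ (a - 1)) *
   expR (- (2^-1 * (s * \sum_(j < n) p j))))%R.
Proof.
move=> s0 p0; rewrite /gamma_kernel big_split/= -expR_sum sumrN -!mulr_sumr.
congr (_ * _)%R.
have -> : (s `^ (n%:R * (a - 1)) = \prod_(j < n) s `^ (a - 1))%R.
  by rewrite prodr_const card_ord mulrC powRrM powR_mulrn ?powR_ge0.
rewrite -big_split/=; apply: eq_bigr => j _.
by rewrite powRM//; exact: ltW.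
Qed.

(** The exponents add up as [m + (m + 1)(a - 1) = (m + 1) a - 1]: this is where the shape [n * a] of
    [tau] enters. *)
Lemma polar_jacobian m (s : R) : (0 < s)%R ->
  (s ^+ m * s `^ (m.+1%:R * (a - 1)) = s `^ (m.+1%:R * a - 1))%R.
Proof.
move=> s0; rewrite -powR_mulrn ?ltW// -powRD; last by rewrite (gt_eqF s0) implybT.
by congr powR; rewrite -natr1; ring.
Qed.

End polar_pointwise.

(** * The joint law of [phi] and [theta] in the variable [t = tau * phi] *)

Section joint_law.
Local Open Scope ereal_scope.
Context (R : realType) (m : nat) (a : R).
Context (d : measure_display) (Omega : measurableType d).
Variable P : probability Omega R.
Local Notation n := m.+1.
Local Notation leb := (@lebesgue_measure R).
Local Notation lebn := (lebesgue_tuple R).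
Variables (tau : {RV P >-> R}) (phi theta : {RV P >-> n.-tuple R}).
Hypothesis tau_gamma : is_gamma (n%:R * a) 2^-1 (distribution P tau).
Hypothesis phi_dirichlet : is_dirichlet a (distribution P phi).
Hypothesis phi_tau_indep : independent_RVs phi tau.
Hypothesis theta_DE : cond_independent_with_laws theta (fun w => (phi w, tau w))
       (fun j z => laplace_law (tnth z.1 j * z.2)).

Local Notation nonneg := [set p : n.-tuple R | forall j, (0 <= tnth p j)%R].

Lemma measurable_nonneg_tuple : measurable nonneg.
Proof.
rewrite (_ : nonneg = tuple_rectangle (fun=> `[0%R, +oo[%classic : set R)).
  by apply: measurable_tuple_rectangle => j; exact: measurable_itv.
by apply/seteqP; split=> p /= p0 j; have := p0 j; rewrite /= in_itv/= andbT.
Qed.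

Lemma probability_setI1 (A E : set Omega) : measurable A -> measurable E ->
  P E = 1 -> P (A `&` E) = P A.
Proof.
move=> mA mE PE1; rewrite [RHS](measureDI P mA mE).
have PEc : P (~` E) = 0 by rewrite probability_setC// PE1 subee.
rewrite [X in _ = X + _](_ : _ = 0) ?add0e//.
apply: subset_measure0 PEc; [exact: measurableD|exact: measurableC|].
exact: subIsetr.
Qed.

(** The density formula yields the same integral for [setT] as for the positive half-line, and for
    [setT] it is 1. The next lemma argues likewise. *)
Lemma tau_pos : P (tau @^-1` `]0%R, +oo[) = 1.
Proof.
have [c c0 tauE] := tau_gamma.
transitivity (distribution P tau setT); last exact: probability_setT.
by rewrite (tauE setT)// -[LHS]/(distribution P tau _) tauE ?setIid ?setTI.
Qed.

Lemma phi_nonneg : P (phi @^-1` nonneg) = 1.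
Proof.
have [c c0 phiE] := phi_dirichlet.
transitivity (distribution P phi setT); last exact: probability_setT.
rewrite (phiE setT)// -[LHS]/(distribution P phi _) phiE; last first.
  exact: measurable_nonneg_tuple.
by congr (integral _ _ _); apply/seteqP; split=> x /= []; split.
Qed.

(** The support events have probability one and can be inserted. On them each scale
    [tnth (phi w) j * tau w] is nonnegative, so that [laplace_law] may be replaced by
    [laplace_mass]. *)
Lemma conditional_rectangle (A : set (n.-tuple R)) (B : 'I_n -> set R) :
  measurable A -> (forall j, measurable (B j)) ->
  P (phi @^-1` A `&` theta @^-1` tuple_rectangle B) =
  \int[P]_w ((\1_((A `&` nonneg) `*` `]0%R, +oo[) (phi w, tau w))%:E *
    \prod_(j < n) laplace_mass (B j) (tnth (phi w) j * tau w)).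
Proof.
move=> mA mB; set C := (A `&` nonneg) `*` `]0%R, +oo[.
have mpre d' (T' : measurableType d') (X : {RV P >-> T'}) D :
    measurable D -> measurable (X @^-1` D).
  by move=> mD; rewrite -[X in measurable X]setTI; exact: measurable_funP.
have mC : measurable C.
  by apply: measurableX => //; apply: measurableI => //; exact: measurable_nonneg_tuple.
rewrite -(probability_setI1 (E := phi @^-1` nonneg)); last 3 first.
- apply: measurableI; apply: mpre => //; exact: measurable_tuple_rectangle.
- exact: (mpre _ _ _ _ measurable_nonneg_tuple).
- exact: phi_nonneg.
rewrite -(probability_setI1 (E := tau @^-1` `]0%R, +oo[)); last 3 first.
- apply: measurableI; last exact: (mpre _ _ _ _ measurable_nonneg_tuple).
  by apply: measurableI; apply: mpre => //; exact: measurable_tuple_rectangle.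
- by apply: mpre.
- exact: tau_pos.
transitivity (P ([set w | forall j, B j (tnth (theta w) j)] `&`
    (fun w => (phi w, tau w)) @^-1` C)).
  congr (P _); apply/seteqP; split=> w /=.
    by move=> [[[]]].
  by move=> [? [[]]].
rewrite theta_DE// integral_mkcond; apply: eq_integral => w _.
rewrite patchE indicE; case: ifPn => [|wC]; last first.
  by rewrite memNset ?mul0e// => Cw; move/negP: wC; apply; exact/mem_set.
rewrite inE/= => Cw; rewrite mem_set// mul1e; move: Cw.
move=> [[_ /= phi0]]; rewrite in_itv/= andbT => tau0.
apply: eq_bigr => j _; rewrite laplace_law_mass//.
by rewrite mulr_ge0// ltW.
Qed.

Let W (A : set (n.-tuple R)) (B : 'I_n -> set R) (p : n.-tuple R * R) : \bar R :=
  (\1_((A `&` nonneg) `*` `]0%R, +oo[) p)%:E *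
  \prod_(j < n) laplace_mass (B j) (tnth p.1 j * p.2).

Let G (A : set (n.-tuple R)) (B : 'I_n -> set R) (t : n.-tuple R) : \bar R :=
  (\1_A (normalize_tuple (tnth t)))%:E *
  \prod_(j < n) ((gamma_kernel a (tnth t j))%:E * laplace_mass (B j) (tnth t j)).

(** The pointwise form of the change of variables: the densities of [tau] and [phi] times [W] give
    the Jacobian times [G] at [s * p]. If some coordinate of [p] is nonpositive, a Laplace mass
    vanishes on both sides, so the power laws are applied to positive numbers only. *)
Let W_G (c c' s : R) (p : n.-tuple R) A B : (0 < s)%R ->
  (\sum_(j < n) tnth p j = 1)%R ->
  (\1_`]0%R, +oo[ s * (c * (s `^ (n%:R * a - 1) * expR (- (2^-1 * s)))))%:E *
  ((\1_nonneg p * (c' * \prod_(j < n) tnth p j `^ (a - 1)))%:E * W A B (p, s)) =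
  (s ^+ m)%:E * ((c * c')%:E * G A B [tuple of map ( *%R s) p]).
Proof.
move=> s0 p1; rewrite /W /G.
have [[i pi0]|/forallNP p0] := pselect (exists i, tnth p i <= 0)%R.
  rewrite [X in _ * (_ * (_ * X))](bigD1 i)//= laplace_mass0 ?pmulr_lle0//.
  rewrite [X in _ = _ * (_ * (_ * X))](bigD1 i)//= laplace_mass0.
    by rewrite !(mule0, mul0e).
  by rewrite tnth_map pmulr_rle0.
have {}p0 j : (0 < tnth p j)%R by rewrite ltNge; apply/negP/p0.
rewrite (normalize_tuple_scale _ p1) ?gt_eqF// !indicE.
rewrite [s \in _]mem_set/= ?in_itv/= ?s0// [p \in nonneg]mem_set/=; last first.
  by move=> j; exact: ltW.
rewrite (_ : (p, s) \in _ = (p \in A)); last first.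
  apply/idP/idP => [|pA]; first by rewrite inE => -[[]] /mem_set.
  apply/mem_set; split=> /=; last by rewrite in_itv/= s0.
  by split; [exact/set_mem|move=> j; exact: ltW].
rewrite big_split/= prodEFin; under [in RHS]eq_bigr do rewrite tnth_map.
rewrite (prod_gamma_kernel_scale _ s0 p0) p1 mulr1 !mul1r.
under [X in _ = _ * (_ * (_ * (_ * X)))]eq_bigr do rewrite tnth_map mulrC.
rewrite !muleA; congr (_ * _); rewrite -!EFinM; congr EFin.
rewrite -polar_jacobian//; ring.
Qed.

Lemma joint_rectangle_polar : exists2 c : R, (0 < c)%R &
  forall (A : set (n.-tuple R)) (B : 'I_n -> set R),
  measurable A -> (forall j, measurable (B j)) ->
  P (phi @^-1` A `&` theta @^-1` tuple_rectangle B) =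
  \int[lebn n]_t (c%:E * ((\1_A (normalize_tuple (tnth t)))%:E *
    \prod_(j < n) ((gamma_kernel a (tnth t j))%:E *
                   laplace_mass (B j) (tnth t j)))).
Proof.
have [c c0 tauE] := tau_gamma; have [c' c'0 phiE] := phi_dirichlet.
(* The product of the normalizing constants of the gamma and Dirichlet densities. *)
exists (c * c')%R => [|A B mA mB]; first exact: mulr_gt0.
have G0 t : 0 <= G A B t.
  rewrite mule_ge0//; apply: prode_ge0 => j _.
  by rewrite mule_ge0 ?lee_fin ?gamma_kernel_ge0 ?laplace_mass_ge0.
have mG : measurable_fun setT (G A B).
  apply: emeasurable_funM.
    apply/measurable_EFinP.
    exact: (measurableT_comp _ (@measurable_normalize_tuple R n)).
  apply: emeasurable_prod => j.
  apply: (measurableT_comp (f := fun u => (gamma_kernel a u)%:E *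
    laplace_mass (B j) u) _ (measurable_tnth j)).
  apply: emeasurable_funM; last exact: measurable_laplace_mass.
  apply/measurable_EFinP; exact: measurable_gamma_kernel.
have W0 p : 0 <= W A B p.
  by rewrite mule_ge0//; apply: prode_ge0 => j _; exact: laplace_mass_ge0.
have mnn := measurable_nonneg_tuple.
have mW : measurable_fun setT (W A B).
  apply: emeasurable_funM.
    apply/measurable_EFinP; apply: measurable_indic.
    by apply: measurableX => //; exact: measurableI.
  apply: emeasurable_prod => j.
  apply: (measurableT_comp (measurable_laplace_mass (mB j))).
  apply: measurable_funM => //.
  exact: (measurableT_comp (measurable_tnth j) measurable_fst).
have msp := @measurable_simplex_point R m.
have mpos : measurable (`]0%R, +oo[%classic : set R) by exact: measurable_itv.
have cc0 : (0 <= c * c')%R by rewrite mulr_ge0 ?ltW.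
rewrite conditional_rectangle// (integral_lebesgue_tuple_polar
  (G := fun t => (c * c')%:E * G A B t)); last 3 first.
- by move=> t; rewrite mule_ge0.
- exact: measurable_funeM.
- move=> t t0; rewrite /G.
  (* A nonpositive total forces a nonpositive coordinate, where the Laplace mass is zero. *)
  have [i ti] : exists i, (tnth t i <= 0)%R.
    apply: contrapT => /forallNP tp; move/negP: t0; apply.
    have {}tp j : (0 < tnth t j)%R by rewrite ltNge; apply/negP/tp.
    by rewrite big_ord_recl ltr_pwDl// sumr_ge0// => j _; exact: ltW.
  by rewrite (bigD1 i)//= laplace_mass0// !(mule0, mul0e).
transitivity (\int[P]_w W A B (phi w, tau w)); first by [].
rewrite ge0_independent_integral//.
(* [f] and, below, [D] are the densities of [tau] and [phi] with their supports encoded by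
   indicators, in the form that [ge0_integral_transfer] expects. *)
pose f s : \bar R := (\1_`]0%R, +oo[ s *
  (c * (s `^ (n%:R * a - 1) * expR (- (2^-1 * s)))))%:E.
have f0 s : 0 <= f s.
  by rewrite /f lee_fin mulr_ge0// mulr_ge0 ?(ltW c0)// mulr_ge0 ?powR_ge0 ?expR_ge0.
have mf : measurable_fun [set: measurableTypeR R] f.
  apply/measurable_EFinP; apply: measurable_funM => //.
  apply: measurable_funM => //; apply: measurable_funM.
    exact: measurable_powR.
  by apply: measurableT_comp => //; apply: measurableT_comp => //;
    exact: measurable_funM.
have fE S : measurable S -> distribution P tau S =
    \int[leb]_s (f s * (\1_S (s : R))%:E).
  move=> mS; rewrite tauE// integral_mkcond; apply: eq_integral => s _.
  by rewrite epatch_indic indicI /f -!EFinM; congr EFin; rewrite /=; ring.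
have mid : measurable_fun [set: measurableTypeR R] (fun s => s : R) by [].
rewrite (ge0_integral_transfer (mu := leb) (nu := distribution P tau)
  f0 mf mid fE); last 2 first.
- by move=> s; exact: integral_ge0.
- exact: measurable_fun_fubini_tonelli_G.
apply: eq_integral => s _.
case: ifPn => s0; last first.
  by rewrite /f indicE memNset ?mul0r ?mul0e//= in_itv/= (negbTE s0).
pose D (x : m.-tuple R) : \bar R := let p := simplex_point (n := n) x in
  (\1_nonneg p * (c' * \prod_(j < n) tnth p j `^ (a - 1)))%:E.
have D0 x : 0 <= D x.
  rewrite /D lee_fin mulr_ge0// mulr_ge0 ?(ltW c'0)//.
  by apply: prodr_ge0 => i _; exact: powR_ge0.
have mD : measurable_fun setT D.
  have mDp : measurable_fun setT (fun p : n.-tuple R =>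
      \1_nonneg p * (c' * \prod_(j < n) tnth p j `^ (a - 1)))%R.
    apply: measurable_funM => //; apply: measurable_funM => //.
    apply: measurable_prod => j _.
    exact: (measurableT_comp (measurable_powR _) (measurable_tnth j)).
  apply/measurable_EFinP; exact: (measurableT_comp mDp msp).
have DE S : measurable S -> distribution P phi S =
    \int[lebn m]_x (D x * (\1_S (simplex_point (n := n) x))%:E).
  move=> mS; rewrite phiE// integral_mkcond; apply: eq_integral => x _.
  rewrite patchE /D !indicE.
  have [px|npx] := pselect (nonneg (simplex_point (n := n) x)); last first.
    rewrite [_ \in nonneg]memNset//= mul0r mul0e.
    by rewrite ifF//; apply/negbTE/negP; rewrite inE/= => -[].
  rewrite [_ \in nonneg]mem_set// mul1r -EFinM.
  have [Sx|nSx] := pselect (S (simplex_point (n := n) x)).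
    by rewrite !mem_set//= mulr1.
  by rewrite !memNset//= ?mulr0// => -[].
have mWs : measurable_fun setT (fun p : n.-tuple R => W A B (p, s)).
  apply: (measurableT_comp mW (g := fun p : n.-tuple R => (p, s))).
  exact: measurable_fun_pair.
rewrite (ge0_integral_transfer (mu := lebn m) (nu := distribution P phi) D0 mD msp DE)//.
have mDW : measurable_fun setT (fun x : m.-tuple R =>
    D x * W A B (simplex_point (n := n) x, s)).
  by apply: emeasurable_funM => //; exact: (measurableT_comp mWs msp).
rewrite -(ge0_integralZl (lebn m) measurableT mDW); last 2 first.
- by move=> x _; exact: mule_ge0.
- exact: f0.
have mGs : measurable_fun setT (fun x : m.-tuple R => (c * c')%:E *
    G A B [tuple of map ( *%R s) (simplex_point (n := n) x)]).
  apply: measurable_funeM; apply: (measurableT_comp mG).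
  exact: (measurableT_comp (@measurable_tuple_scale R s n) msp).
rewrite -(ge0_integralZl (lebn m) measurableT mGs); last 2 first.
- by move=> x _; exact: mule_ge0.
- by rewrite lee_fin exprn_ge0// ltW.
apply: eq_integral => x _; apply: W_G => //; exact: sum_simplex_point.
Qed.

End joint_law.

(** * The posterior kernel *)

Section posterior_kernel.
Local Open Scope ereal_scope.
Context (R : realType) (a : R) (n : nat).
Local Notation leb := (@lebesgue_measure R).
Local Notation lebn := (lebesgue_tuple R).

Let J (p : n.-tuple R * n.-tuple R) : \bar R := (joint_pdf_tuple a p.1 p.2)%:E.

Let J0 p : 0 <= J p.
Proof. by rewrite lee_fin joint_pdf_tuple_ge0. Qed.

Let mJ : measurable_fun setT J.
Proof. by apply/measurable_EFinP; exact: measurable_joint_pdf_tuple. Qed.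

Definition giG_kernel := density_kernel (lebn n) J0 mJ (@measurable_id _ _ setT).

(** The name refers to dividing [t] by its sum; the total mass is not normalized and equals that of
    [giG_kernel]. *)
Definition normalized_giG_kernel :=
  density_kernel (lebn n) J0 mJ (@measurable_normalize_tuple R n).

HB.instance Definition _ := Kernel.on normalized_giG_kernel.

Lemma normalized_giG_kernelE y A : normalized_giG_kernel y A =
  \int[lebn n]_t ((joint_pdf_tuple a y t)%:E *
                  (\1_A (normalize_tuple (tnth t)))%:E).
Proof. by []. Qed.

Lemma giG_kernelE y A : giG_kernel y A =
  \int[lebn n]_t ((joint_pdf_tuple a y t)%:E * (\1_A t)%:E).
Proof. by []. Qed.

Lemma indic_tuple_rectangle (B : 'I_n -> set R) (t : n.-tuple R) :
  \1_(tuple_rectangle B) t = (\prod_(j < n) \1_(B j) (tnth t j))%R :> R.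
Proof.
rewrite indicE; have [Bt|/existsNP[i Bti]] := pselect (tuple_rectangle B t).
  by rewrite mem_set// big1// => j _; rewrite indicE mem_set.
rewrite memNset; last by move=> /(_ i).
by rewrite (bigD1 i)//= indicE memNset// mul0r.
Qed.

Lemma measurable_indic_joint_pdf (B : set R) y : measurable B ->
  measurable_fun setT (fun u => (\1_B u * joint_pdf a y u)%:E).
Proof.
move=> mB; apply/measurable_EFinP; apply: measurable_funM => //.
apply: (measurableT_comp (@measurable_joint_pdf R a) (g := fun u : R => (y, u))).
exact: measurable_fun_pair.
Qed.

(** The density is a product over the coordinates, and so is the measure; this is the source of the
    independence of the [T_j]. *)
Lemma giG_kernel_rectangle (B : 'I_n -> set R) y :
  (forall j, measurable (B j)) ->
  giG_kernel y (tuple_rectangle B) =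
  \prod_(j < n) \int[leb]_u (\1_(B j) u * joint_pdf a (tnth y j) u)%:E.
Proof.
move=> mB; rewrite -ge0_integral_lebesgue_tuple_prod; last 2 first.
- by move=> j u; rewrite lee_fin mulr_ge0 ?joint_pdf_ge0.
- by move=> j; exact: measurable_indic_joint_pdf.
rewrite giG_kernelE; apply: eq_integral => t _.
by rewrite prodEFin big_split/= -indic_tuple_rectangle EFinM muleC.
Qed.

End posterior_kernel.

(** * The joint law of [phi] and [theta] in the variable [theta] *)

Section joint_law_density.
Local Open Scope ereal_scope.
Context (R : realType) (m : nat) (a : R).
Context (d : measure_display) (Omega : measurableType d).
Variable P : probability Omega R.
Local Notation n := m.+1.
Local Notation leb := (@lebesgue_measure R).
Local Notation lebn := (lebesgue_tuple R).
Variables (tau : {RV P >-> R}) (phi theta : {RV P >-> n.-tuple R}).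
Hypothesis tau_gamma : is_gamma (n%:R * a) 2^-1 (distribution P tau).
Hypothesis phi_dirichlet : is_dirichlet a (distribution P phi).
Hypothesis phi_tau_indep : independent_RVs phi tau.
Hypothesis theta_DE : cond_independent_with_laws theta (fun w => (phi w, tau w))
       (fun j z => laplace_law (tnth z.1 j * z.2)).

(** Each gamma factor times Laplace mass is an integral over one observation, so their product is an
    integral over [y]; Tonelli then exchanges [t] and [y]. *)
Let joint_rectangle : exists2 c : R, (0 < c)%R &
  forall (A : set (n.-tuple R)) (B : 'I_n -> set R),
  measurable A -> (forall j, measurable (B j)) ->
  P (phi @^-1` A `&` theta @^-1` tuple_rectangle B) =
  \int[lebn n]_y (c%:E * normalized_giG_kernel a y A *
                  (\1_(tuple_rectangle B) y)%:E).
Proof.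
have [c c0 Pc] := joint_rectangle_polar tau_gamma phi_dirichlet phi_tau_indep theta_DE.
exists c => // A B mA mB; rewrite {}Pc//.
have mR := measurable_tuple_rectangle mB.
pose H (p : n.-tuple R * n.-tuple R) : \bar R :=
  c%:E * ((\1_A (normalize_tuple (tnth p.1)))%:E *
  (\1_(tuple_rectangle B) p.2 * joint_pdf_tuple a p.2 p.1)%:E).
have c0' : 0 <= c%:E by rewrite lee_fin ltW.
have H0 p : 0 <= H p.
  by rewrite /H mule_ge0// mule_ge0// lee_fin mulr_ge0 ?joint_pdf_tuple_ge0.
have mRJ : measurable_fun setT (fun p : n.-tuple R * n.-tuple R =>
    \1_(tuple_rectangle B) p.2 * joint_pdf_tuple a p.2 p.1)%R.
  apply: measurable_funM; first exact: measurableT_comp.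
  apply: (measurableT_comp (@measurable_joint_pdf_tuple R a n)
    (g := fun p : n.-tuple R * n.-tuple R => (p.2, p.1))).
  exact: measurable_fun_pair.
have mH : measurable_fun setT H.
  apply: measurable_funeM; apply: emeasurable_funM; apply/measurable_EFinP => //.
  apply: (measurableT_comp (measurable_indic mA)).
  exact: (measurableT_comp (@measurable_normalize_tuple R n)).
transitivity (\int[lebn n]_t \int[lebn n]_y H (t, y)).
  apply: eq_integral => t _.
  have mRt : measurable_fun setT (fun y : n.-tuple R =>
      (\1_(tuple_rectangle B) y * joint_pdf_tuple a y t)%:E).
    apply/measurable_EFinP; apply: (measurableT_comp mRJ
      (g := fun y : n.-tuple R => (t, y))).
    exact: measurable_fun_pair.
  rewrite /H /= ge0_integralZl//; last 2 first.
  - exact: (measurable_funeM _ mRt).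
  - by move=> y _; rewrite mule_ge0// lee_fin mulr_ge0 ?joint_pdf_tuple_ge0.
  rewrite ge0_integralZl//; last first.
    by move=> y _; rewrite lee_fin mulr_ge0 ?joint_pdf_tuple_ge0.
  congr (_ * (_ * _)).
  under eq_bigr => j _ do rewrite -gamma_kernel_laplace_mass//.
  rewrite -(ge0_integral_lebesgue_tuple_prod
    (f := fun j y => (\1_(B j) y * joint_pdf a y (tnth t j))%:E)); last 2 first.
  - by move=> j y; rewrite lee_fin mulr_ge0 ?joint_pdf_ge0.
  - move=> j; apply/measurable_EFinP; apply: measurable_funM => //.
    apply: (measurableT_comp (@measurable_joint_pdf R a)
      (g := fun y : R => (y, tnth t j))).
    exact: measurable_fun_pair.
  apply: eq_integral => y _.
  by rewrite prodEFin big_split/= -indic_tuple_rectangle.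
rewrite (fubini_tonelli H mH H0); apply: eq_integral => y _.
rewrite normalized_giG_kernelE muleAC -ge0_integralZl//; last 3 first.
- apply: emeasurable_funM; apply/measurable_EFinP.
    apply: (measurableT_comp (@measurable_joint_pdf_tuple R a n)
      (g := fun t : n.-tuple R => (y, t))).
    exact: measurable_fun_pair.
  apply: (measurableT_comp (measurable_indic mA)).
  exact: measurable_normalize_tuple.
- by move=> t _; rewrite mule_ge0// lee_fin joint_pdf_tuple_ge0.
- by rewrite mule_ge0.
apply: eq_integral => t _; rewrite /H /= EFinM -!muleA; congr (_ * _).
by rewrite muleCA; congr (_ * _); exact: muleC.
Qed.

(** For fixed [A] both sides are measures in [B] that agree on rectangles, and the left one is
    finite. *)
Lemma joint_law_density : exists2 c : R, (0 < c)%R &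
  forall A B : set (n.-tuple R), measurable A -> measurable B ->
  P (phi @^-1` A `&` theta @^-1` B) =
  \int[lebn n]_y (c%:E * normalized_giG_kernel a y A * (\1_B y)%:E).
Proof.
have [c c0 Pc] := joint_rectangle; exists c => // A B mA mB.
have mphiA : measurable (phi @^-1` A).
  by rewrite -[X in measurable X]setTI; exact: measurable_funP.
(* The one-point parameter space [unit] lets [density_measure] provide both sides as single measures
   [m1] and [m2]. *)
pose f1 (p : unit * Omega) : \bar R := (\1_(phi @^-1` A) p.2)%:E.
have f10 p : 0 <= f1 p by rewrite lee_fin.
have mf1 : measurable_fun setT f1.
  by apply/measurable_EFinP; exact: measurableT_comp.
pose f2 (p : unit * n.-tuple R) : \bar R := c%:E * normalized_giG_kernel a p.2 A.
have f20 p : 0 <= f2 p by rewrite mule_ge0// lee_fin ltW.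
have mf2 : measurable_fun setT f2.
  apply: measurable_funeM.
  have mk := measurable_kernel (normalized_giG_kernel a (n := n)) A mA.
  pose g (y : n.-tuple R) : \bar R := normalized_giG_kernel a y A.
  have mg : measurable_fun setT g by exact: mk.
  exact: (measurableT_comp mg (@measurable_snd _ _ unit (n.-tuple R))).
have mth : measurable_fun setT theta by exact: measurable_funP.
pose m1 : {measure set (n.-tuple R) -> \bar R} :=
  density_measure P f10 mf1 mth tt.
pose m2 : {measure set (n.-tuple R) -> \bar R} :=
  density_measure (lebn n) f20 mf2 (@measurable_id _ _ setT) tt.
have m1E C : measurable C -> m1 C = P (phi @^-1` A `&` theta @^-1` C).
  move=> mC; have mthC : measurable (theta @^-1` C).
    by rewrite -[X in measurable X]setTI; exact: measurable_funP.
  rewrite -[in RHS](setIT (_ `&` _)) -integral_indic//; last exact: measurableI.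
  by apply: eq_integral => w _; rewrite indicI EFinM.
rewrite -m1E// -[RHS]/(m2 B); apply: tuple_measure_unique => //.
  rewrite m1E// preimage_setT setIT.
  by rewrite (le_lt_trans (probability_le1 P mphiA))// ltry.
move=> D mD; rewrite (m1E _ (measurable_tuple_rectangle mD)).
exact: (Pc A D mA mD).
Qed.

End joint_law_density.

(** * Normalizing the product kernel into a law of independent giG variables *)

Lemma mnormalizeE d (T : measurableType d) (R : realType)
    (mu : {measure set T -> \bar R}) (P : probability T R) A :
  (mu setT != 0 -> mu setT != +oo ->
  mnormalize mu P A = mu A * (fine (mu setT))^-1%:E)%E.
Proof. by move=> /negbTE mu0 /negbTE muoo; rewrite /mnormalize mu0 muoo. Qed.

Section coordinate.
Context d (T : measurableType d) (n : nat).

(** Named so that it can carry a measurable function structure and serve as the random variable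
    [T_j]. *)
Definition coordinate (j : 'I_n) (t : n.-tuple T) : T := tnth t j.

HB.instance Definition _ j :=
  isMeasurableFun.Build _ _ _ _ (coordinate j) (measurable_tnth j).

End coordinate.

Section normalized_giG.
Local Open Scope ereal_scope.
Context (R : realType) (a : R) (n : nat) (y : n.-tuple R).
Local Notation leb := (@lebesgue_measure R).
Variable default : probability (n.-tuple R) R.
Hypothesis ev0 : giG_kernel a y setT != 0.
Hypothesis evoo : giG_kernel a y setT != +oo.

Local Notation Q := (mnormalize (giG_kernel a y) default).

Let I j (B : set R) := \int[leb]_u (\1_B u * joint_pdf a (tnth y j) u)%:E.

Let I_ge0 j B : 0 <= I j B.
Proof. by apply: integral_ge0 => u _; rewrite lee_fin mulr_ge0 ?joint_pdf_ge0. Qed.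

Let QE A : Q A = giG_kernel a y A * (fine (giG_kernel a y setT))^-1%:E.
Proof. exact: mnormalizeE. Qed.

Let evE : giG_kernel a y setT = \prod_(j < n) I j setT.
Proof.
by rewrite -giG_kernel_rectangle//; congr (giG_kernel _ _ _); apply/seteqP.
Qed.

Let I_neq0 j : I j setT != 0.
Proof.
apply: contra_neq ev0 => Ij0; rewrite evE (bigD1 j)//= Ij0 mul0e//.
Qed.

(** An infinite factor makes the product infinite because the remaining factors are positive, hence
    [I_neq0] comes first. *)
Let I_fin j : I j setT \is a fin_num.
Proof.
rewrite ge0_fin_numE// ltey; apply: contra_neq evoo => Ijoo.
rewrite evE (bigD1 j)//= Ijoo gt0_mulye//; elim/big_ind : _ => //.
- by move=> u v; exact: mule_gt0.
- by move=> i _; rewrite lt0e I_neq0 I_ge0.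
Qed.

Let fine_evV : (fine (giG_kernel a y setT))^-1%:E =
  \prod_(j < n) (fine (I j setT))^-1%:E.
Proof.
rewrite prodEFin prodfV evE; congr (_^-1)%:E.
have -> : \prod_(j < n) I j setT = \prod_(j < n) (fine (I j setT))%:E.
  by apply: eq_bigr => j _; rewrite fineK.
by rewrite prodEFin.
Qed.

Let Q_rectangle (B : 'I_n -> set R) : (forall j, measurable (B j)) ->
  Q (tuple_rectangle B) = \prod_(j < n) (I j (B j) * (fine (I j setT))^-1%:E).
Proof.
by move=> mB; rewrite QE giG_kernel_rectangle// big_split/= fine_evV.
Qed.

Let Q_coordinate j (B : set R) : measurable B ->
  Q (coordinate j @^-1` B) = I j B * (fine (I j setT))^-1%:E.
Proof.
move=> mB.
have -> : coordinate j @^-1` B =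
    tuple_rectangle (fun k => if k == j then B else setT).
  apply/seteqP; split=> t /=; first by move=> Bt k; case: ifPn => // /eqP ->.
  by move=> /(_ j); rewrite eqxx.
rewrite Q_rectangle; last by move=> k; case: ifP.
rewrite (bigD1 j)//= eqxx big1 ?mule1// => k /negbTE ->.
by rewrite -{1}(fineK (I_fin k)) -EFinM divff// fine_eq0.
Qed.

(** The canonical model: the probability space is the space of tuples with the law [Q], and the
    [T_j] are its coordinates. *)
Lemma is_normalized_giG_mnormalize : is_normalized_giG (a - 1) 1
  (fun j => 2 * `|tnth y j|)%R
  (fun A => Q [set t | A (normalize_tuple (tnth t))]).
Proof.
exists _, (n.-tuple R : measurableType _), Q, (fun j => coordinate j); split.
- move=> B mB; rewrite [LHS](Q_rectangle mB); apply: eq_bigr => j _.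
  by apply/esym; exact: Q_coordinate.
- move=> j.
  have z0 : (0 < fine (I j setT))%R.
    by rewrite fine_gt0// lt0e I_neq0 I_ge0 -ge0_fin_numE// I_fin.
  (* The factor [2^-1] comes from [joint_pdf_giG], the other one from normalizing the j-th
     marginal. *)
  exists (2^-1 * (fine (I j setT))^-1)%R => [|A mA].
    by rewrite mulr_gt0 ?invr_gt0.
  transitivity (I j A * (fine (I j setT))^-1%:E); first exact: Q_coordinate.
  rewrite integral_mkcond -ge0_integralZr//; last 3 first.
  - exact: measurable_indic_joint_pdf.
  - by move=> u _; rewrite lee_fin mulr_ge0 ?joint_pdf_ge0.
  - by rewrite lee_fin invr_ge0 ltW.
  apply: eq_integral => u _; rewrite epatch_indic indicI -!EFinM; congr EFin.
  have posE : (\1_(`]0, +oo[%classic) (u : R) = (0 < u :> R)%R%:R :> R)%R.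
    by rewrite indicE; congr (nat_of_bool _)%:R; apply/idP/idP;
      rewrite inE/= in_itv/= andbT.
  rewrite /= posE; have [u0|u0] := ltP 0%R u.
    by rewrite joint_pdf_giG// mulr1; ring.
  by rewrite joint_pdf0// !(mulr0, mul0r).
- by [].
Qed.

End normalized_giG.

(** * Disintegration of the joint law along [theta] *)

Theorem theorem4p3 (R : realType) (n : nat) (n_ge1 : (1 <= n)%N)
    (a : R) (a_gt0 : 0 < a)
    (d : measure_display) (Omega : measurableType d) (P : probability Omega R)
    (tau : {RV P >-> R}) (phi theta : {RV P >-> n.-tuple R})
    (tau_gamma : is_gamma (n%:R * a) 2^-1 (distribution P tau))
    (phi_dirichlet : is_dirichlet a (distribution P phi))
    (phi_tau_indep : independent_RVs phi tau)
    (theta_DE : cond_independent_with_laws theta (fun w => (phi w, tau w))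
       (fun j z => laplace_law (tnth z.1 j * z.2))) :
  exists K : R.-pker n.-tuple R ~> n.-tuple R,
    is_cond_distribution phi theta K /\
    {ae P, forall w,
      is_normalized_giG (a - 1) 1 (fun j => 2 * `|tnth (theta w) j|)
        (K (theta w))}.
Proof.
case: n n_ge1 phi theta tau_gamma phi_dirichlet phi_tau_indep theta_DE => // m _.
move=> phi theta tau_gamma phi_dirichlet phi_tau_indep theta_DE.
have [c c0 Pc] := joint_law_density tau_gamma phi_dirichlet phi_tau_indep theta_DE.
pose U := normalized_giG_kernel a (n := m.+1).
(* An arbitrary fallback law, taken by the normalized kernel where the total mass [ev y] is 0 or
   infinite. *)
pose x0 : m.+1.-tuple R := [tuple of nseq m.+1 0].
pose default : probability (m.+1.-tuple R) R := \d_x0.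
pose ev y : \bar R := U y setT.
have U0 y A : (0 <= U y A)%E by exact: measure_ge0.
have mU A : measurable A -> measurable_fun setT (fun y => U y A).
  by move=> mA; exact: (measurable_kernel (normalized_giG_kernel a (n := m.+1)) A mA).
pose f y : \bar R := (c%:E * ev y)%E.
have f0 y : (0 <= f y)%E by rewrite mule_ge0// lee_fin ltW.
have mf : measurable_fun setT f by apply: measurable_funeM; exact: mU.
have thetaE B : measurable B -> distribution P theta B =
    (\int[lebesgue_tuple R m.+1]_y (f y * (\1_B y)%:E))%E.
  by move=> mB; rewrite -Pc// setTI.
(* [f] is the density of [theta]; it integrates to 1, hence is finite almost everywhere. *)
have f_fin : {ae lebesgue_tuple R m.+1, forall y, f y \is a fin_num}.
  have : (lebesgue_tuple R m.+1).-integrable setT f.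
    apply/integrableP; split => //.
    under eq_integral do rewrite gee0_abs//.
    have := thetaE _ measurableT; rewrite probability_setT.
    under [in X in _ = X -> _]eq_integral do rewrite indicT mule1.
    by move=> <-; rewrite ltry.
  by move=> /integrable_ae => /(_ measurableT); apply: filterS => y; exact.
have ev_fin y : f y \is a fin_num -> ev y \is a fin_num.
  move=> fy; rewrite ge0_fin_numE//; rewrite ltey; apply: contraTneq fy => evy.
  by rewrite /f evy gt0_muley// lte_fin.
(* Multiplying by the total mass undoes the normalization, even at mass 0, where monotonicity forces
   [U y A] to vanish too. *)
have evU y A : measurable A -> f y \is a fin_num ->
    (ev y * knormalize U default y A = U y A)%E.
  move=> mA /ev_fin evy; rewrite /knormalize /= /mnormalize -/(ev y).
  have [ev0|ev0] := eqVneq (ev y) 0%E.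
    rewrite ev0 mul0e; apply/esym/eqP; rewrite eq_le U0 andbT -ev0.
    by apply: le_measure; rewrite ?inE.
  rewrite (negbTE (_ : ev y != +oo%E)); last by case: (ev y) evy.
  rewrite /= muleCA -[X in (_ * (X * _))%E](fineK evy) -EFinM divff ?mule1//.
  by rewrite fine_eq0.
exists (knormalize U default); split.
  move=> A B mA mB; rewrite Pc//.
  have mK : measurable_fun setT (fun y => knormalize U default y A).
    exact: (measurable_kernel (knormalize U default) A mA).
  have m1B : measurable_fun setT (fun y : m.+1.-tuple R => (\1_B y)%:E : \bar R).
    by apply/measurable_EFinP.
  have mKB := emeasurable_funM mK m1B.
  have KB0 y : (0 <= knormalize U default y A * (\1_B y)%:E)%E by rewrite mule_ge0.
  transitivity (\int[distribution P theta]_y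
      (knormalize U default y A * (\1_B y)%:E))%E; last first.
    rewrite ge0_integral_distribution// [RHS]integral_mkcond.
    by apply: eq_integral => w _; rewrite epatch_indic.
  rewrite (ge0_integral_transfer (mu := lebesgue_tuple R m.+1)
    (nu := distribution P theta) f0 mf (@measurable_id _ _ setT) thetaE)//.
  apply: ge0_ae_eq_integral => //.
  - by apply: emeasurable_funM => //; apply: measurable_funeM; exact: mU.
  - exact: emeasurable_funM.
  - by move=> y _; rewrite mule_ge0// mule_ge0// lee_fin ltW.
  - by move=> y _; rewrite mule_ge0.
  - apply: filterS f_fin => y fy _.
    by rewrite muleA; congr (_ * _)%E; rewrite /f -muleA evU.
(* The values of [theta] at which the kernel falls back on [default]. *)
pose N : set (m.+1.-tuple R) := ev @^-1` [set 0%E; +oo%E].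
have mN : measurable N.
  rewrite -[X in measurable X]setTI; apply: mU => //.
  by apply: measurableU; exact: emeasurable_set1.
exists (theta @^-1` N); split.
- by rewrite -[X in measurable X]setTI; exact: measurable_funP.
(* [theta] avoids [N] almost surely: its density vanishes where [ev] is 0, and [ev] is infinite only
   on a Lebesgue-null set. *)
- rewrite -[LHS]/(distribution P theta N) thetaE//.
  rewrite -[RHS](integral0 (lebesgue_tuple R m.+1) setT).
  apply: ge0_ae_eq_integral => //.
  - by apply: emeasurable_funM => //; apply/measurable_EFinP.
  - by move=> y _; rewrite mule_ge0.
  - apply: filterS f_fin => y fy _; rewrite indicE.
    case: (boolP (y \in N)) => [|_]; last by rewrite mule0.
    rewrite inE => -[ev0|evoo]; first by rewrite /f ev0 mule0 mul0e.
    by have := ev_fin _ fy; rewrite evoo.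
move=> w; apply: contra_notP => /= wN.
(* [U] and [giG_kernel] have the same total mass by conversion, so being outside [N] is a statement
   about [giG_kernel]. *)
have ev0 : giG_kernel a (theta w) setT != 0%E.
  by apply/eqP => ev0; apply: wN; left.
have evoo : giG_kernel a (theta w) setT != +oo%E.
  by apply/eqP => evoo; apply: wN; right.
have := is_normalized_giG_mnormalize default ev0 evoo.
congr (is_normalized_giG _ _ _ _); apply/funext => A.
(* Both sides divide by the same mass, and [U] is the image of [giG_kernel] under normalization of
   tuples. *)
rewrite [LHS]mnormalizeE// [RHS](@mnormalizeE _ _ _ (U (theta w)))//.
Qed.
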